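(* Let $\mathbb{F}$ be a field of any characteristic, let $A$ be a commutative associative $\mathbb{F}$-algebra with identity element, and let $D$ be a nonzero $\mathbb{F}$-vector space spanned by some pairwise commuting $\mathbb{F}$-derivations of $A$. Let $A[D]=A\otimes_{\mathbb{F}}\mathbb{F}[D]$ be the associated associative algebra of Weyl type and $\mathbb{F}_1=\{u\in A : \partial(u)=0 \text{ for all } \partial\in D\}$. Then the associative algebra $A[D]$ is simple if and only if $A$ is $D$-simple and $\mathbb{F}_1[D]$ acts faithfully on $A$.
   Context: Let $\{\partial_i\mid i\in I\}$ be an $\mathbb{F}$-basis of $D$ (with $I$ totally ordered), and let $J$ be the set of all families $\alpha=(\alpha_i)_{i\in I}$ of nonnegative integers with $\alpha_i=0$ for all but finitely many $i$. $\mathbb{F}[D]$ denotes the (formal, commutative) polynomial algebra in the variables $\partial_i$, with basis the monomials $\partial^{(\alpha)}=\prod_{i\in I}\partial_i^{\alpha_i}$, $\alpha\in J$. The vector space $A[D]=A\otimes_{\mathbb{F}}\mathbb{F}[D]$ acts on $A$ by $(u\otimes\partial^{(\alpha)})(x)=u\cdot\big(\prod_{i}\partial_i^{\alpha_i}\big)(x)$ for $u,x\in A$, where the product is composition of the derivations; this gives a linear map $\theta:A[D]\to \mathrm{Hom}_{\mathbb{F}}(A,A)$. The associative product on $A[D]$ is $$(u\otimes\partial^{(\alpha)})\cdot(v\otimes\partial^{(\beta)})=u\sum_{\gamma\in J,\ \gamma_i\le\alpha_i\ \forall i}\binom{\alpha}{\gamma}\,\partial^{(\gamma)}(v)\otimes\partial^{(\alpha+\beta-\gamma)},\qquad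 \binom{\alpha}{\gamma}=\prod_{i\in I}\binom{\alpha_i}{\gamma_i},$$ so that $\theta$ is a homomorphism of associative algebras. $\mathbb{F}_1[D]$ denotes the subspace $\mathbb{F}_1\otimes_{\mathbb{F}}\mathbb{F}[D]$ of $A[D]$; a subspace of $A[D]$ acts faithfully on $A$ if the restriction of $\theta$ to it is injective. $A$ is $D$-simple if $A$ has no ideals $\mathcal{I}$ other than $0$ and $A$ with $\partial(\mathcal{I})\subseteq\mathcal{I}$ for all $\partial\in D$. *)

(* Defs.v *)
From HB Require Import structures.
From mathcomp Require Export all_boot all_order all_algebra finmap.
From mathcomp.multinomials Require Export monalg.

Set Implicit Arguments.
Unset Strict Implicit.
Unset Printing Implicit Defensive.

Import GRing.Theory.

Local Open Scope fset_scope.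
Local Open Scope ring_scope.

(* {cmonom I} is the type of finitely supported families alpha : I -> nat,
   written multiplicatively: mmul alpha beta is the pointwise sum and
   divcm alpha gamma is the pointwise (truncated) difference. *)
Section MultiIndex.
Variable I : choiceType.
Implicit Types alpha gamma : {cmonom I}.

(* The set of all gamma <= alpha (pointwise), see belowP: such a gamma is
   determined by its values on the support of alpha, which are at most
   mdeg alpha. *)
Definition below alpha : {fset {cmonom I}} :=
  let box := {ffun finsupp alpha -> 'I_(mdeg alpha).+1} in
  [fset [cmonom (g i : nat) | i : finsupp alpha]%M
     | g : box in [pred g : box | [forall i, (g i <= alpha (val i))%N]]].

Definition mbinom alpha gamma : nat :=
  (\prod_(i <- finsupp alpha) 'C(alpha i, gamma i))%N.

Lemma belowP alpha gamma :
  reflect (forall i, gamma i <= alpha i)%N (gamma \in below alpha).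
Proof.
apply: (iffP (imfsetP _ _ _ _)) => [[g /= + -> i]|le_ga].
  move=> /forallP le_g.
  rewrite cmE fsfun_ffun; case: insubP => [j _ <-|//] /=; exact: le_g.
have le_deg (i : finsupp alpha) : (gamma (val i) < (mdeg alpha).+1)%N.
  rewrite ltnS (leq_trans (le_ga _)) // mdegE.
  by rewrite (big_fsetD1 (val i)) ?(valP i) //= leq_addr.
exists [ffun i : finsupp alpha => Ordinal (le_deg i)].
  by rewrite /in_mem /=; apply/forallP => i; rewrite ffunE; apply: le_ga.
apply/eqP/cmP => i; rewrite cmE fsfun_ffun.
case: insubP => [j _ <-|]; first by rewrite /= ffunE.
by rewrite -cmE_eq0 => /eqP ia0 /=; have := le_ga i; rewrite ia0 leqn0 => /eqP.
Qed.
End MultiIndex.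

Section WeylType.
Variables (F : fieldType) (A : comAlgType F).

Definition derivation (f : A -> A) : Prop :=
  (forall (c : F) (u v : A), f (c *: u + v) = c *: f u + f v) /\
  (forall u v : A, f (u * v) = f u * v + u * f v).

(* Vector spaces of F-linear operators on A are given as predicates on A -> A,
   with operators compared pointwise. *)
Implicit Types (S D : (A -> A) -> Prop).

Definition pairwise_commuting S : Prop :=
  forall f g, S f -> S g -> forall x, f (g x) = g (f x).

Definition spanned_by S D : Prop :=
  forall f, D f <->
    exists (n : nat) (c : 'I_n -> F) (g : 'I_n -> A -> A),
      (forall k, S (g k)) /\ forall x, f x = \sum_(k < n) c k *: g k x.

Definition nonzero_space D : Prop :=
  exists f, D f /\ exists x, f x <> 0.

Definition linearly_independent (I : choiceType) (d : I -> A -> A) : Prop :=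
  forall (s : {fset I}) (c : I -> F),
    (forall x, \sum_(i <- s) c i *: d i x = 0) ->
    forall i, i \in s -> c i = 0.

Definition is_basis (I : choiceType) D (d : I -> A -> A) : Prop :=
  linearly_independent d /\ spanned_by (fun f => exists i, f = d i) D.

Definition constants D (u : A) : Prop := forall f, D f -> f u = 0.

Definition ideal_of_A (S : A -> Prop) : Prop :=
  [/\ S 0, forall u v, S u -> S v -> S (u + v)
    & forall u v, S v -> S (u * v)].

Definition D_simple D : Prop :=
  forall S : A -> Prop, ideal_of_A S ->
    (forall f, D f -> forall u, S u -> S (f u)) ->
    (forall u, S u -> u = 0) \/ (forall u, S u).

Section Product.
Variables (I : choiceType) (d : I -> A -> A).

(* The composite of the (d i)^(alpha i); as the d i commute, the order in which
   the support of alpha is listed does not matter. *)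
Definition dmonom (alpha : {cmonom I}) (x : A) : A :=
  foldr (fun i y => iter (alpha i) (d i) y) x (finsupp alpha).

(* A (x) F[D] is the free A-module on the monomials in the d i, that is
   {malg A[{cmonom I}]}, with << u *g alpha >> standing for u (x) d^(alpha).
   The commutative product that {malg _} carries in the library is not the one
   considered here. *)
Local Notation AD := {malg A[{cmonom I}]}.

Definition theta (p : AD) (x : A) : A :=
  \sum_(alpha <- msupp p) p@_alpha * dmonom alpha x.

Definition weyl_mul (p q : AD) : AD :=
  \sum_(alpha <- msupp p) \sum_(beta <- msupp q) \sum_(gamma <- below alpha)
    << p@_alpha * (dmonom gamma q@_beta *+ mbinom alpha gamma)
       *g divcm (mmul alpha beta) gamma >>.

(* The scalar c : F acts on AD as c%:A : A. *)
Definition two_sided_ideal (S : AD -> Prop) : Prop :=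
  [/\ S 0,
      forall (c : F) p q, S p -> S q -> S (c%:A *: p + q),
      forall p q, S q -> S (weyl_mul p q)
    & forall p q, S p -> S (weyl_mul p q)].

Definition weyl_simple : Prop :=
  (exists p q, weyl_mul p q <> 0) /\
  forall S : AD -> Prop, two_sided_ideal S ->
    (forall p, S p -> p = 0) \/ (forall p, S p).

Definition acts_faithfully (S : AD -> Prop) : Prop :=
  forall p q, S p -> S q -> (forall x, theta p x = theta q x) -> p = q.

(* F_1 (x) F[D], for D the space spanned by the d i *)
Definition constants_AD D (p : AD) : Prop :=
  forall alpha, constants D p@_alpha.

End Product.
End WeylType.

(* Main.v *)
Require Import Defs.
From Stdlib Require Import Classical.

Set Implicit Arguments.
Unset Strict Implicit.
Unset Printing Implicit Defensive.

Import GRing.Theory.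

Local Open Scope fset_scope.
Local Open Scope ring_scope.

(** Write [p, q] for the commutator in A[D].

    If A[D] is simple, the two conditions come from two explicit ideals. A
    D-stable ideal J of A gives the ideal of elements with all coefficients in
    J ([two_sided_ideal_coef]), so J is 0 or A. The kernel of theta is an ideal
    ([two_sided_ideal_ker]), because theta is multiplicative ([theta_mul]), and
    it does not contain 1; so theta is injective, on all of A[D]. That theta is
    multiplicative is the multivariate Leibniz rule ([Leibniz]).

    Conversely, a nonzero ideal S is shown to contain 1 ([two_sided_one]). Two
    kinds of commutators stay in S and make an element smaller.
    - [d_i, q] applies d_i to every coefficient of q ([mcoeff_comm_der]). It
      kills the monomials whose coefficient is a constant and creates none.
    - [q, x] with x in A has smaller degree than q ([mdeg_comm_C]).
    Take u in S, nonzero, of least degree and then of fewest monomials. The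
    coefficients at a fixed monomial of u, over all elements of S supported in
    the support of u, form a D-stable ideal of A; hence some such q has
    coefficient 1 there ([two_sided_monic]). Then every [d_i, q] is 0, as it
    has fewer monomials, so q lies in F_1[D]; and every [q, x] is 0, as it has
    smaller degree. The constant coefficient of q x is theta(q)(x)
    ([mcoeff1_mulC]) and that of x q is x q_0, where q_0 is the constant
    coefficient of q; so q and q_0 act in the same way on A. By faithfulness
    q = q_0, and as q has a coefficient 1 this means q = 1. In positive
    characteristic p, [q, x] may vanish for all x although q has positive
    degree, for instance if q is a p-th power d_i^p that acts as 0 on A; this is
    what faithfulness excludes. *)

(** * Multi-indices *)

Section MultiIndexTheory.
Variable I : choiceType.
Implicit Types alpha beta gamma delta : {cmonom I}.

Lemma divcmK alpha gamma :
  (forall i, gamma i <= alpha i)%N -> mmul gamma (divcm alpha gamma) = alpha.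
Proof. by move=> le; apply/eqP/cmP => i; rewrite cmM divcmE subnKC. Qed.

Lemma divcm1 alpha : divcm alpha mone = alpha.
Proof. by apply/eqP/cmP => i; rewrite divcmE cm1 subn0. Qed.

Lemma mmulcmK alpha beta : divcm (mmul alpha beta) alpha = beta.
Proof. by apply/eqP/cmP => i; rewrite divcmE cmM addKn. Qed.

Lemma mmulcmI alpha : injective (mmul alpha).
Proof. by move=> b c e; rewrite -(mmulcmK alpha b) e mmulcmK. Qed.

Lemma divcmMU alpha beta gamma :
  divcm (mmul alpha beta) (mmul alpha gamma) = divcm beta gamma.
Proof. by apply/eqP/cmP => i; rewrite !divcmE !cmM subnDl. Qed.

Lemma divcmM alpha beta gamma : (forall i, gamma i <= alpha i)%N ->
  divcm (mmul alpha beta) gamma = mmul (divcm alpha gamma) beta.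
Proof.
by move=> le; apply/eqP/cmP => i; rewrite cmM !divcmE cmM addnBAC.
Qed.

Lemma divcm_eq1 alpha gamma : (forall i, gamma i <= alpha i)%N ->
  (divcm alpha gamma == mone) = (gamma == alpha).
Proof.
move=> le; apply/eqP/eqP => [e|->].
  by rewrite -[RHS](divcmK le) e mulm1.
by apply/eqP/cmP => i; rewrite divcmE cm1 subnn.
Qed.

Lemma ltn_mdeg_divcm alpha gamma :
  (forall i, gamma i <= alpha i)%N -> gamma != mone ->
  (mdeg (divcm alpha gamma) < mdeg alpha)%N.
Proof.
move=> le; rewrite -mdeg_eq0 -lt0n => gt0.
by rewrite -[in ltnRHS](divcmK le) mdegM -[ltnLHS]add0n ltn_add2r.
Qed.

Lemma cmonom_ind (P : {cmonom I} -> Prop) :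
  P mone -> (forall i beta, P beta -> P (mmul (ucm i) beta)) ->
  forall alpha, P alpha.
Proof.
move=> P1 PU alpha; have [n] := ubnP (mdeg alpha).
elim: n alpha => // n IH alpha; have [->//|neq deg_lt] := eqVneq alpha mone.
have /fset0Pn[i] : finsupp alpha != fset0.
  apply: contra neq => /eqP s0; apply/cmP => i; apply/eqP.
  by rewrite cm1 cmE_eq0 s0.
rewrite -cmE_neq0 -lt0n => ai.
have le j : (ucm i j <= alpha j)%N by rewrite cmU; case: eqVneq => [<-|].
rewrite -(divcmK le); apply/PU/IH; rewrite -ltnS.
apply: leq_trans deg_lt; rewrite ltnS; apply: ltn_mdeg_divcm => //.
by rewrite cm1_eq1.
Qed.

Lemma below1 : below (mone : {cmonom I}) = [fset mone].
Proof.
apply/fsetP => g; rewrite in_fset1; apply/idP/idP => [/belowP le|/eqP ->].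
  by apply/cmP => i; apply/eqP; have := le i; rewrite cm1 leqn0.
by apply/belowP => i; rewrite cm1.
Qed.

Lemma mem_below1 alpha : (mone : {cmonom I}) \in below alpha.
Proof. by apply/belowP => i; rewrite cm1. Qed.

Lemma mem_below_id alpha : alpha \in below alpha.
Proof. by apply/belowP. Qed.

Lemma belowU (i : I) : below (ucm i) = [fset (mone : {cmonom I}); ucm i].
Proof.
apply/fsetP => g; rewrite in_fset2; apply/idP/idP => [/belowP le|].
  have [gi|gi] := posnP (g i); apply/orP; [left|right]; apply/cmP => j.
    have [<-|ij] := eqVneq i j; first by rewrite cm1.
    by apply/eqP; have := le j; rewrite cmU (negPf ij) leqn0 cm1.
  apply/eqP; rewrite eqn_leq le cmU.
  by case: eqVneq => [<-|].
by case/orP => /eqP->; apply/belowP => j; rewrite ?cm1.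
Qed.

(** The product over the support of alpha ignores the indices outside it, so
    that mbinom alpha gamma need not vanish when gamma is not below alpha. This
    variant does vanish there, as the recursion of Pascal's triangle requires,
    and agrees with mbinom for gamma below alpha. *)
Definition cbinom alpha gamma : nat :=
  (\prod_(i <- finsupp gamma) 'C(alpha i, gamma i))%N.

Lemma cbinomEw (s : {fset I}) alpha gamma : finsupp gamma `<=` s ->
  cbinom alpha gamma = (\prod_(i <- s) 'C(alpha i, gamma i))%N.
Proof.
move=> le; apply: big_fset_incl => // i _.
by rewrite -cmE_eq0 => /eqP ->; rewrite bin0.
Qed.

Lemma mbinomE alpha gamma : gamma \in below alpha ->
  mbinom alpha gamma = cbinom alpha gamma.
Proof.
move=> /belowP le; rewrite (@cbinomEw (finsupp alpha)) //.
apply/fsubsetP => i; rewrite -!cmE_neq0 -!lt0n => /leq_trans; exact.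
Qed.

Lemma cbinom_eq0 alpha gamma : gamma \notin below alpha -> cbinom alpha gamma = 0%N.
Proof.
move=> /belowP nle.
have [i] : exists i, ~ (gamma i <= alpha i)%N by apply: not_all_ex_not.
move/negP; rewrite -ltnNge => lt.
rewrite /cbinom (big_fsetD1 i) /=; first by rewrite bin_small.
by rewrite -cmE_neq0 -lt0n (leq_ltn_trans _ lt).
Qed.

Lemma mbinom1 alpha : mbinom alpha mone = 1%N.
Proof. by rewrite mbinomE ?mem_below1 // /cbinom mdom1 big_seq_fset0. Qed.

Lemma mbinomn alpha : mbinom alpha alpha = 1%N.
Proof. by rewrite /mbinom big1 // => i _; rewrite binn. Qed.

(** Pascal's rule in the variable i; the other factors do not change. *)
Lemma cbinomU i beta delta :
  cbinom (mmul (ucm i) beta) delta =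
  (cbinom beta delta + (0 < delta i) * cbinom beta (divcm delta (ucm i)))%N.
Proof.
pose s := i |` finsupp delta.
have sub : finsupp delta `<=` s by rewrite fsubsetUr.
have sub' : finsupp (divcm delta (ucm i)) `<=` s.
  apply: fsubset_trans sub; apply/fsubsetP => j; rewrite -!cmE_neq0 -!lt0n divcmE.
  by move=> /leq_trans; apply; rewrite leq_subr.
rewrite !(cbinomEw _ sub) (cbinomEw _ sub').
have si : i \in s by rewrite !inE eqxx.
have rest alpha gamma : (forall j, j != i -> alpha j = beta j) ->
    (forall j, j != i -> gamma j = delta j) ->
  (\prod_(j <- s `\ i) 'C(alpha j, gamma j) =
   \prod_(j <- s `\ i) 'C(beta j, delta j))%N.
  move=> ha hg; rewrite !big_seq; apply: eq_bigr => j; rewrite !inE => /andP[ji _].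
  by rewrite ha ?hg.
rewrite !(big_fsetD1 i si) /= !rest //.
- rewrite cmM divcmE cmUU add1n mulnA -mulnDl; congr (_ * _)%N.
  by case: (delta i) => [|k]; rewrite ?bin0 // binS subn1 mul1n.
- by move=> j ji; rewrite divcmE cmU eq_sym (negPf ji) subn0.
- by move=> j ji; rewrite cmM cmU eq_sym (negPf ji).
Qed.

(** The form of Pascal's rule that the inductive step of [Leibniz] consumes: one
    more derivative d_i falls either on the left factor or on the right one. *)
Lemma big_below_mulU (V : nmodType) i beta (T : {cmonom I} -> V) :
  \sum_(delta <- below (mmul (ucm i) beta))
     T delta *+ mbinom (mmul (ucm i) beta) delta =
  \sum_(gamma <- below beta) T (mmul (ucm i) gamma) *+ mbinom beta gamma +
  \sum_(gamma <- below beta) T gamma *+ mbinom beta gamma.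
Proof.
set B := below (mmul _ _).
have sub : below beta `<=` B.
  apply/fsubsetP => g /belowP le; apply/belowP => j; rewrite cmM.
  by rewrite (leq_trans (le j)) // leq_addl.
(* With cbinom, both parts may be summed over the larger set B. *)
transitivity (\sum_(delta <- B) T delta *+ cbinom beta delta +
  \sum_(delta <- B)
     T delta *+ ((0 < delta i) * cbinom beta (divcm delta (ucm i)))%N).
  rewrite -big_split !big_seq; apply: eq_bigr => g gB /=.
  by rewrite mbinomE // cbinomU mulrnDr.
rewrite addrC; congr (_ + _); last first.
  rewrite -(big_fset_incl _ sub).
    by rewrite !big_seq; apply: eq_bigr => g gb; rewrite mbinomE.
  by move=> g _ /cbinom_eq0 ->.
(* The delta with 0 < delta i are the products of the i-th variable with some
   gamma; those with gamma not below beta contribute 0. *)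
pose B' := [fset mmul (ucm i) g | g in below beta].
have sub' : B' `<=` B.
  apply/fsubsetP => _ /imfsetP[g /belowP le ->]; apply/belowP => j.
  by rewrite !cmM leq_add2l.
rewrite -(big_fset_incl _ sub').
  rewrite big_imfset /=; last by move=> ? ? _ _; apply: mmulcmI.
  rewrite !big_seq; apply: eq_bigr => g gb.
  by rewrite cmM cmUU mmulcmK mul1n mbinomE.
move=> g /belowP gB; case: posnP => [//|gi]; rewrite mul1n => gB'.
have le j : (ucm i j <= g j)%N by rewrite cmU; case: eqVneq => [<-|].
rewrite cbinom_eq0 //; apply: contra gB' => /belowP le'.
apply/imfsetP; exists (divcm g (ucm i)); last by rewrite divcmK.
exact/belowP.
Qed.
End MultiIndexTheory.

(** * Derivations *)

Section Derivation.
Variables (F : fieldType) (A : comAlgType F) (f : A -> A).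
Hypothesis f_der : derivation f.

Lemma derD x y : f (x + y) = f x + f y.
Proof. by have [lin _] := f_der; rewrite -[x]scale1r lin !scale1r. Qed.

Lemma der0 : f 0 = 0.
Proof. by apply: (@addrI _ (f 0)); rewrite -derD !addr0. Qed.

Lemma derZ c x : f (c *: x) = c *: f x.
Proof. by have [lin _] := f_der; rewrite -[c *: x]addr0 lin der0 addr0. Qed.

Lemma derM x y : f (x * y) = f x * y + x * f y.
Proof. by have [_ ->] := f_der. Qed.

Lemma der1 : f 1 = 0.
Proof.
by apply: (@addrI _ (f 1)); rewrite addr0 -{3}[1]mulr1 derM mulr1 mul1r.
Qed.

Lemma der_sum (J : Type) (r : seq J) (g : J -> A) :
  f (\sum_(j <- r) g j) = \sum_(j <- r) f (g j).
Proof. exact: (big_morph f derD der0). Qed.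

Lemma derMn x n : f (x *+ n) = f x *+ n.
Proof. by elim: n => [|n IH]; rewrite ?mulr0n ?der0 // !mulrS derD IH. Qed.

Lemma der_comm_span n (c : 'I_n -> F) (g : 'I_n -> A -> A) h :
  (forall k x, f (g k x) = g k (f x)) ->
  (forall x, h x = \sum_(k < n) c k *: g k x) -> forall x, f (h x) = h (f x).
Proof.
move=> fg hE x; rewrite !hE der_sum.
by apply: eq_bigr => k _; rewrite derZ fg.
Qed.
End Derivation.

Lemma derivation_span (F : fieldType) (A : comAlgType F) n (c : 'I_n -> F)
    (g : 'I_n -> A -> A) h :
  (forall k, derivation (g k)) -> (forall x, h x = \sum_(k < n) c k *: g k x) ->
  derivation h.
Proof.
move=> g_der hE; split=> [a u v|u v]; rewrite !hE.
  rewrite scaler_sumr -big_split; apply: eq_bigr => k _ /=.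
  by rewrite derD // derZ // scalerDr !scalerA mulrC.
rewrite mulr_suml mulr_sumr -big_split; apply: eq_bigr => k _ /=.
by rewrite derM // scalerDr scalerAl scalerAr.
Qed.

Section Derivations.
Variables (F : fieldType) (A : comAlgType F) (I : choiceType) (d : I -> A -> A).
Hypothesis d_derivation : forall i, derivation (d i).
Hypothesis d_comm : forall i j x, d i (d j x) = d j (d i x).
Implicit Types (alpha beta gamma : {cmonom I}).
Local Notation dm := (dmonom d).

(** dmonom for an arbitrary list of indices, which allows induction. *)
Definition iter_ders alpha s x := foldr (fun i y => iter (alpha i) (d i) y) x s.

Lemma iter_derC i j n x : d j (iter n (d i) x) = iter n (d i) (d j x).
Proof. by elim: n => //= n IH; rewrite d_comm IH. Qed.

Lemma iter_ders_derC alpha s j x :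
  d j (iter_ders alpha s x) = iter_ders alpha s (d j x).
Proof. by elim: s => //= i s IH; rewrite iter_derC IH. Qed.

Lemma iter_ders_iterC alpha s j n x :
  iter n (d j) (iter_ders alpha s x) = iter_ders alpha s (iter n (d j) x).
Proof. by elim: n => //= n ->; rewrite iter_ders_derC. Qed.

Lemma iter_iterC i j m n x :
  iter m (d j) (iter n (d i) x) = iter n (d i) (iter m (d j) x).
Proof. by elim: m => //= m ->; rewrite iter_derC. Qed.

(** Moving one index to the front; by induction the result of a list of
    commuting operators is invariant under permutation. *)
Lemma iter_ders_rem alpha i s x : i \in s ->
  iter_ders alpha s x = iter (alpha i) (d i) (iter_ders alpha (rem i s) x).
Proof.
elim: s => //= j s IH; rewrite inE eq_sym; case: eqVneq => [-> //|_ /= si].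
by rewrite IH // iter_iterC.
Qed.

Lemma iter_ders_perm alpha s t x : perm_eq s t ->
  iter_ders alpha s x = iter_ders alpha t x.
Proof.
elim: s t => [|i s IH] t pst.
  by rewrite (perm_nilP (_ : perm_eq t [::])) // perm_sym.
have ti : i \in t by rewrite -(perm_mem pst) mem_head.
rewrite (iter_ders_rem _ _ ti) /= (IH (rem i t)) //.
by rewrite -(perm_cons i) (perm_trans pst) // perm_to_rem.
Qed.

(** A common list of indices for alpha and beta is what [dmonomM] needs; the
    extra indices contribute zeroth iterates. *)
Lemma dmonomEw alpha (s : {fset I}) x : finsupp alpha `<=` s ->
  dm alpha x = iter_ders alpha s x.
Proof.
move=> sub; transitivity (iter_ders alpha [seq i <- s | alpha i != 0%N] x).
  apply: iter_ders_perm; apply: uniq_perm; rewrite ?filter_uniq ?fset_uniq //.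
  move=> i; rewrite mem_filter cmE_neq0.
  by case: (boolP (i \in _)) => // /(fsubsetP sub) ->.
elim: (enum_fset s) => //= i t IH.
by case: eqP => [->|_] /=; rewrite IH.
Qed.

Lemma iter_dersM alpha beta s x :
  iter_ders (mmul alpha beta) s x = iter_ders alpha s (iter_ders beta s x).
Proof.
by elim: s => //= i s ->; rewrite cmM iterD iter_ders_iterC.
Qed.

Lemma dmonomM alpha beta x : dm (mmul alpha beta) x = dm alpha (dm beta x).
Proof.
rewrite (@dmonomEw _ (finsupp alpha `|` finsupp beta)) ?mdomD //.
by rewrite iter_dersM -!dmonomEw ?fsubsetUl ?fsubsetUr.
Qed.

Lemma dmonom1 x : dm mone x = x.
Proof. by rewrite /dmonom mdom1. Qed.

Lemma dmonomU i x : dm (ucm i) x = d i x.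
Proof.
rewrite (@dmonomEw _ [fset i]) ?mdomU // (@iter_ders_perm _ _ [:: i]) /= ?cmUU //.
by apply: uniq_perm; rewrite ?fset_uniq // => j; rewrite in_fset1 inE.
Qed.

Lemma dmonomUM i alpha x : dm (mmul (ucm i) alpha) x = d i (dm alpha x).
Proof. by rewrite dmonomM dmonomU. Qed.

Lemma dmonomD alpha x y : dm alpha (x + y) = dm alpha x + dm alpha y.
Proof.
elim/cmonom_ind: alpha => [|i b IH]; first by rewrite !dmonom1.
by rewrite !dmonomUM IH derD.
Qed.

Lemma dmonom0 alpha : dm alpha 0 = 0.
Proof. by apply: (@addrI _ (dm alpha 0)); rewrite -dmonomD !addr0. Qed.

Lemma dmonom_sum alpha (J : Type) (r : seq J) (f : J -> A) :
  dm alpha (\sum_(j <- r) f j) = \sum_(j <- r) dm alpha (f j).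
Proof. exact: (big_morph (dm alpha) (dmonomD alpha) (dmonom0 alpha)). Qed.

Lemma dmonom_one alpha : alpha != mone -> dm alpha 1 = 0.
Proof.
elim/cmonom_ind: alpha => [|i b _ _]; first by rewrite eqxx.
by rewrite mulmC dmonomM dmonomU der1 // dmonom0.
Qed.

(** By induction on alpha, one derivative at a time; [big_below_mulU] merges the
    two families of terms that each derivative produces. *)
Lemma Leibniz alpha u v : dm alpha (u * v) =
  \sum_(gamma <- below alpha)
    (dm gamma u * dm (divcm alpha gamma) v) *+ mbinom alpha gamma.
Proof.
elim/cmonom_ind: alpha => [|i b IH].
  by rewrite below1 big_seq_fset1 divcm1 !dmonom1 mbinom1.
rewrite (big_below_mulU i b (fun g => dm g u * dm (divcm (mmul (ucm i) b) g) v)).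
rewrite dmonomUM IH (der_sum (d_derivation i)) -big_split !big_seq.
apply: eq_bigr => g gb /=; rewrite derMn // derM // mulrnDl.
rewrite divcmMU dmonomUM; congr (_ + _ * _ *+ _).
by rewrite [in RHS]mulmC divcmM ?[mmul _ (ucm i)]mulmC ?dmonomUM //; apply/belowP.
Qed.

(** * The action and the product of A[D] *)

Local Notation AD := {malg A[{cmonom I}]}.
Local Notation wmul := (weyl_mul d).
Implicit Types p q : AD.

(** The product of u (x) d^alpha and v (x) d^beta. *)
Definition weyl_term u alpha v beta : AD :=
  \sum_(gamma <- below alpha)
    << u * (dm gamma v *+ mbinom alpha gamma) *g divcm (mmul alpha beta) gamma >>.

Lemma weyl_term0l alpha v beta : weyl_term 0 alpha v beta = 0.
Proof. by rewrite /weyl_term big1 // => g _; rewrite mul0r monalgU0. Qed.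

Lemma weyl_term0r u alpha beta : weyl_term u alpha 0 beta = 0.
Proof.
by rewrite /weyl_term big1 // => g _; rewrite dmonom0 mul0rn mulr0 monalgU0.
Qed.

Lemma mcoeff_term u alpha v beta delta : (weyl_term u alpha v beta)@_delta =
  \sum_(gamma <- below alpha)
    u * (dm gamma v *+ mbinom alpha gamma)
      *+ (divcm (mmul alpha beta) gamma == delta).
Proof. by rewrite raddf_sum; apply: eq_bigr => g _; apply: mcoeffU. Qed.

Lemma weyl_mulUl u alpha q :
  wmul << u *g alpha >> q = \sum_(beta <- msupp q) weyl_term u alpha q@_beta beta.
Proof.
rewrite /weyl_mul (big_fset_incl _ msuppU_le) /= => [|a _ /mcoeff_outdom ->].
  by rewrite big_seq_fset1 mcoeffUU.
by rewrite big1 // => b _; rewrite -/(weyl_term 0 _ _ _) weyl_term0l.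
Qed.

Lemma weyl_mulUr p v beta :
  wmul p << v *g beta >> = \sum_(alpha <- msupp p) weyl_term p@_alpha alpha v beta.
Proof.
apply: eq_bigr => a _.
rewrite (big_fset_incl _ msuppU_le) /= => [|b _ /mcoeff_outdom ->].
  by rewrite big_seq_fset1 mcoeffUU.
by rewrite -/(weyl_term _ _ 0 _) weyl_term0r.
Qed.

Lemma thetaE p x : theta d p x = mmap idfun (dm^~ x) p.
Proof. by []. Qed.

Lemma thetaU u alpha x : theta d << u *g alpha >> x = u * dm alpha x.
Proof. by rewrite thetaE mmapU. Qed.

Lemma theta_sum (J : Type) (r : seq J) (f : J -> AD) x :
  theta d (\sum_(j <- r) f j) x = \sum_(j <- r) theta d (f j) x.
Proof. by rewrite thetaE raddf_sum. Qed.

(** On monomials, multiplicativity of theta is the Leibniz rule. *)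
Lemma theta_term u alpha v beta x :
  theta d (weyl_term u alpha v beta) x = u * dm alpha (v * dm beta x).
Proof.
rewrite theta_sum Leibniz mulr_sumr !big_seq; apply: eq_bigr => g /belowP gb.
by rewrite thetaU divcmM // dmonomM -mulrA mulrnAl.
Qed.

Lemma theta_mul p q x : theta d (wmul p q) x = theta d p (theta d q x).
Proof.
rewrite theta_sum; apply: eq_bigr => a _.
rewrite theta_sum [theta d q x]/theta dmonom_sum mulr_sumr.
by apply: eq_bigr => b _; rewrite -theta_term.
Qed.

Lemma mcoeff_sumU (f : A -> A) q alpha : f 0 = 0 ->
  (\sum_(beta <- msupp q) << f q@_beta *g beta >>)@_alpha = f q@_alpha.
Proof.
move=> f0; rewrite raddf_sum /=.
under eq_bigr do rewrite mcoeffU.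
have [qa|/mcoeff_outdom qa] := boolP (alpha \in msupp q).
  rewrite (big_fsetD1 alpha qa) /= eqxx mulr1n.
  rewrite big_seq big1 ?addr0 // => b.
  by rewrite in_fsetD1 => /andP[/negPf->].
rewrite qa f0; apply: big1 => b _.
by case: eqP => [->|]; rewrite ?qa ?f0.
Qed.

Lemma weyl_mulCl u q : wmul << u *g mone >> q = u *: q.
Proof.
rewrite weyl_mulUl; apply/malgP => a; rewrite mcoeffZ -(mcoeff_sumU _ _ (mulr0 u)).
congr mcoeff; apply: eq_bigr => b _.
by rewrite /weyl_term below1 big_seq_fset1 dmonom1 mbinom1 mul1m divcm1.
Qed.

Lemma weyl_term_r1 u alpha beta :
  weyl_term u alpha 1 beta = << u *g mmul alpha beta >>.
Proof.
rewrite /weyl_term (big_fsetD1 mone) ?mem_below1 //= dmonom1 mbinom1 mulr1 divcm1.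
rewrite big_seq big1 ?addr0 // => g; rewrite in_fsetD1 => /andP[g1 _].
by rewrite dmonom_one // mul0rn mulr0 monalgU0.
Qed.

Lemma weyl_mulr1 p : wmul p << 1 *g mone >> = p.
Proof.
rewrite weyl_mulUr [RHS]monalgE.
by apply: eq_bigr => a _; rewrite weyl_term_r1 mulm1.
Qed.

(** In d_i q the Leibniz rule gives q d_i and the terms where d_i hits a
    coefficient; only the latter survive in the commutator. *)
Lemma mcoeff_comm_der i q alpha :
  (wmul << 1 *g ucm i >> q - wmul q << 1 *g ucm i >>)@_alpha = d i q@_alpha.
Proof.
rewrite -(mcoeff_sumU _ _ (der0 (d_derivation i))); congr mcoeff.
rewrite weyl_mulUl weyl_mulUr -sumrB; apply: eq_bigr => b _.
rewrite weyl_term_r1 /weyl_term belowU big_fsetU1 ?big_seq_fset1 /=; last first.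
  by rewrite in_fset1 eq_sym cm1_eq1.
rewrite dmonom1 dmonomU mbinom1 mbinomn divcm1 mmulcmK !mul1r [mmul b _]mulmC.
by rewrite addrAC subrr add0r.
Qed.

(** In d^alpha x, the only term without derivatives left is the one in which all
    of them act on x. *)
Lemma mcoeff1_mulC p x : (wmul p << x *g mone >>)@_mone = theta d p x.
Proof.
rewrite weyl_mulUr raddf_sum /theta; apply: eq_bigr => a _.
rewrite /= mcoeff_term mulm1 (big_fsetD1 a (mem_below_id a)) /=.
rewrite divcm_eq1 // eqxx mbinomn big_seq big1 ?addr0 // => g.
rewrite in_fsetD1 => /andP[ga /belowP gb].
by rewrite divcm_eq1 // (negPf ga).
Qed.

(** In d^alpha x, the only term of degree |alpha| is the one in which no derivative
    acts on x, and x p cancels it. *)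
Lemma mdeg_comm_C p x n : {in msupp p, forall alpha, mdeg alpha < n.+1}%N ->
  {in msupp (wmul p << x *g mone >> - x *: p), forall alpha, mdeg alpha < n}%N.
Proof.
move=> lt_p a; rewrite -mcoeff_neq0; apply: contraNltn => le_na; apply/eqP.
rewrite mcoeffB mcoeffZ -(mcoeff_sumU _ _ (mulr0 x)) weyl_mulUr !raddf_sum /=.
rewrite -big_split big_seq; apply: big1 => b bp /=.
rewrite mcoeff_term mcoeffU mulm1 (big_fsetD1 mone (mem_below1 b)) /=.
rewrite dmonom1 mbinom1 divcm1 mulrC addrAC subrr add0r big_seq.
apply: big1 => g; rewrite in_fsetD1 => /andP[g1 /belowP gb].
case: eqP => // e; move: (leq_trans (ltn_mdeg_divcm gb g1) (lt_p b bp)).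
by rewrite e ltnNge le_na.
Qed.

Lemma msupp_comm_der i q :
  msupp (wmul << 1 *g ucm i >> q - wmul q << 1 *g ucm i >>) `<=` msupp q.
Proof.
apply/fsubsetP => a; rewrite -!mcoeff_neq0 mcoeff_comm_der.
by apply: contra => /eqP ->; rewrite der0.
Qed.

(** * Simplicity *)

Section Ideals.
Variable D : (A -> A) -> Prop.
Hypothesis D_span : spanned_by (fun f => exists i, f = d i) D.

Lemma mem_span_der i : D (d i).
Proof.
apply/D_span; exists 1%N, (fun=> 1), (fun=> d i); split=> [_|x]; first by exists i.
by rewrite big_ord1 scale1r.
Qed.

Lemma constantsP u : constants D u <-> forall i, d i u = 0.
Proof.
split=> [Du i|du f /D_span[n [c [g [gd ->]]]]]; first exact/Du/mem_span_der.
by apply: big1 => k _; have [i ->] := gd k; rewrite du scaler0.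
Qed.

Lemma ideal_sum (J : A -> Prop) (T : Type) (r : seq T) (P : pred T) (f : T -> A) :
  ideal_of_A J -> (forall t, J (f t)) -> J (\sum_(t <- r | P t) f t).
Proof. by case=> J0 JD _ Jf; apply: big_ind. Qed.

Lemma ideal_mulrn (J : A -> Prop) u n : ideal_of_A J -> J u -> J (u *+ n).
Proof. by case=> _ _ JM Ju; rewrite -mulr_natl; apply: JM. Qed.

Lemma ideal_span_stable (J : A -> Prop) : ideal_of_A J ->
  (forall i u, J u -> J (d i u)) -> forall f, D f -> forall u, J u -> J (f u).
Proof.
move=> iJ dJ f /D_span[n [c [g [gd fE]]]] u Ju; rewrite fE.
apply: ideal_sum => // k; rewrite -mulr_algl; have [_ _ JM] := iJ; apply: JM.
by have [i ->] := gd k; apply: dJ.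
Qed.

Lemma two_sided_ideal_coef (J : A -> Prop) : ideal_of_A J ->
  (forall i u, J u -> J (d i u)) ->
  two_sided_ideal d (fun p => forall alpha, J p@_alpha).
Proof.
move=> iJ dJ; have [J0 JD JM] := iJ.
have dmJ alpha u : J u -> J (dm alpha u).
  elim/cmonom_ind: alpha => [|i b IH] Ju; first by rewrite dmonom1.
  by rewrite dmonomUM; apply/dJ/IH.
have mulJ p q a : (forall b c, J p@_b \/ J q@_c) -> J (wmul p q)@_a.
  move=> Jpq; rewrite raddf_sum; apply: ideal_sum => // b.
  rewrite raddf_sum; apply: ideal_sum => // c.
  rewrite -/(weyl_term _ _ _ _) /= mcoeff_term; apply: ideal_sum => // g.
  apply: ideal_mulrn => //; have [Jp|Jq] := Jpq b c.
    by rewrite mulrC; apply: JM.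
  by apply: JM; apply: ideal_mulrn => //; apply: dmJ.
split=> [a|c p q Jp Jq a|p q Jq a|p q Jp a].
- by rewrite mcoeff0.
- by rewrite mcoeffD mcoeffZ; apply/JD => //; apply: JM.
- by apply: mulJ; right.
- by apply: mulJ; left.
Qed.

Lemma simple_D_simple : weyl_simple d -> D_simple D.
Proof.
case=> _ simp J iJ DJ.
have dJ i u : J u -> J (d i u) by apply/DJ/mem_span_der.
have [J0 _ _] := iJ.
have [S0|S1] := simp _ (two_sided_ideal_coef iJ dJ); [left=> u|right=> u].
  move=> Ju.
  have /S0/eqP : forall a, J (<< u *g mone >> : AD)@_a.
    by move=> a; rewrite mcoeffU; case: eqP.
  by rewrite monalgU_eq0 => /eqP.
by rewrite -(mcoeffUU (mone : {cmonom I}) u).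
Qed.

Lemma thetaD p q x : theta d (p + q) x = theta d p x + theta d q x.
Proof. by rewrite !thetaE raddfD. Qed.

Lemma thetaB p q x : theta d (p - q) x = theta d p x - theta d q x.
Proof. by rewrite !thetaE raddfB. Qed.

Lemma thetaZ u p x : theta d (u *: p) x = u * theta d p x.
Proof. by rewrite -weyl_mulCl theta_mul thetaU dmonom1. Qed.

Lemma theta0 p : theta d p 0 = 0.
Proof. by apply: big1 => a _; rewrite dmonom0 mulr0. Qed.

Lemma two_sided_ideal_ker : two_sided_ideal d (fun p => forall x, theta d p x = 0).
Proof.
split=> [x|c p q p0 q0 x|p q q0 x|p q p0 x].
- by rewrite thetaE raddf0.
- by rewrite thetaD thetaZ p0 q0 mulr0 addr0.
- by rewrite theta_mul q0 theta0.
- by rewrite theta_mul p0.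
Qed.

Lemma simple_faithful (P : AD -> Prop) : weyl_simple d -> acts_faithfully d P.
Proof.
case=> _ simp p q _ _ pq; have [ker0|kerT] := simp _ two_sided_ideal_ker.
  by apply/eqP; rewrite -subr_eq0; apply/eqP/ker0 => x; rewrite thetaB pq subrr.
have /eqP := kerT << 1 *g mone >> 1.
by rewrite thetaU dmonom1 mulr1 oner_eq0.
Qed.

Section TwoSided.
Variable S : AD -> Prop.
Hypothesis S_ideal : two_sided_ideal d S.

Lemma two_sidedD p q : S p -> S q -> S (p + q).
Proof. by case: S_ideal => _ SD _ _ Sp /(SD 1 _ _ Sp); rewrite !scale1r. Qed.

Lemma two_sidedZ u p : S p -> S (u *: p).
Proof. by case: S_ideal => _ _ SM _ Sp; rewrite -weyl_mulCl; apply: SM. Qed.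

Lemma two_sidedB p q : S p -> S q -> S (p - q).
Proof. by move=> Sp Sq; rewrite -scaleN1r; apply/two_sidedD/two_sidedZ. Qed.

Lemma two_sided_comm p q : S q -> S (wmul p q - wmul q p).
Proof. by case: S_ideal => _ _ SMl SMr Sq; apply: two_sidedB; auto. Qed.

(** The possible coefficients at alpha form a D-stable ideal, as the commutator
    with d_i does not enlarge the support and differentiates the coefficient. *)
Lemma two_sided_monic p alpha : D_simple D -> S p -> alpha \in msupp p ->
  exists q, [/\ S q, msupp q `<=` msupp p & q@_alpha = 1].
Proof.
move=> Dsimple Sp pa.
pose J u := exists q, [/\ S q, msupp q `<=` msupp p & q@_alpha = u].
have iJ : ideal_of_A J.
  split=> [|u v [q [Sq sq <-]] [r [Sr sr <-]]|u _ [q [Sq sq <-]]].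
  - by have [S0 _ _ _] := S_ideal; exists 0; rewrite msupp0 mcoeff0 fsub0set.
  - exists (q + r); rewrite mcoeffD; split=> //; first exact: two_sidedD.
    by apply: fsubset_trans (msuppD_le _ _) _; rewrite fsubUset sq.
  - exists (u *: q); rewrite mcoeffZ; split=> //; first exact: two_sidedZ.
    exact: fsubset_trans (msuppZ_le _ _) sq.
have dJ i u : J u -> J (d i u).
  case=> q [Sq sq <-]; exists (wmul << 1 *g ucm i >> q - wmul q << 1 *g ucm i >>).
  split; [exact: two_sided_comm | | exact: mcoeff_comm_der].
  exact: fsubset_trans (msupp_comm_der _ _) sq.
have [J0|] := Dsimple J iJ (ideal_span_stable iJ dJ); last exact.
have /eqP : p@_alpha = 0 by apply: J0; exists p.
by rewrite mcoeff_eq0 pa.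
Qed.

(** Induction on the degree and, for a given degree bound, on the number of
    monomials replaces the choice of a minimal element. *)
Lemma two_sided_one p : D_simple D -> acts_faithfully d (@constants_AD F A I D) ->
  S p -> p <> 0 -> S << 1 *g mone >>.
Proof.
move=> Dsimple faithful.
suff main n : forall p, S p -> p <> 0 ->
    {in msupp p, forall alpha, mdeg alpha < n}%N -> S << 1 *g mone >>.
  by move=> Sp p0; apply: (main (msize p) p) => // a; apply: msize_mdeg_lt.
elim: n => [|n IHdeg] {}p Sp p0 lt_p.
  case: p0; apply/malgP => a; rewrite mcoeff0; apply: mcoeff_outdom.
  by apply/negP => /lt_p.
have [m] := ubnP #|` msupp p|; elim: m p Sp p0 lt_p => // m IHsize p Sp p0 lt_p.
rewrite ltnS => size_p.
have /fset0Pn[alpha pa] : msupp p != fset0 by rewrite msupp_eq0; apply/eqP.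
have [q [Sq sq qa]] := two_sided_monic Dsimple Sp pa.
have lt_q : {in msupp q, forall beta, mdeg beta < n.+1}%N.
  by move=> b /(fsubsetP sq); apply: lt_p.
apply: NNPP => S1.
have q_const : constants_AD D q.
  move=> b; apply/constantsP => i.
  (* The coefficient 1 at alpha dies, so r has fewer monomials than p. *)
  pose r := wmul << 1 *g ucm i >> q - wmul q << 1 *g ucm i >>.
  suff r0 : r = 0 by rewrite -mcoeff_comm_der -/r r0 mcoeff0.
  apply: NNPP => r_n0; case: S1; apply: (IHsize r) => //.
  - exact: two_sided_comm.
  - by move=> c /(fsubsetP (msupp_comm_der _ _)); apply: lt_q.
  apply: leq_trans size_p; apply: fproper_ltn_card.
  rewrite fproperE (fsubset_trans (msupp_comm_der _ _) sq) /=.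
  apply/fsubsetPn; exists alpha => //.
  by rewrite -mcoeff_eq0 mcoeff_comm_der qa der1.
have qC x : wmul q << x *g mone >> = x *: q.
  apply/eqP; rewrite -subr_eq0; apply/eqP; apply: NNPP => r0; case: S1.
  apply: (IHdeg _ _ r0); last exact: mdeg_comm_C.
  by apply: two_sidedB; [case: S_ideal => _ _ _; apply | exact: two_sidedZ].
have qE : q = << q@_mone *g mone >>.
  apply: faithful => // [b|x].
    rewrite mcoeffU; case: eqP => _; first exact: q_const.
    by apply/constantsP => i; apply: der0.
  by rewrite thetaU dmonom1 -mcoeff1_mulC qC mcoeffZ mulrC.
have aE : alpha = mone.
  apply/eqP; apply: contraT; rewrite eq_sym => /negPf ne.
  by move/eqP: qa; rewrite qE mcoeffU ne mulr0n eq_sym oner_eq0.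
by case: S1; rewrite -qa aE -qE.
Qed.

End TwoSided.
End Ideals.
End Derivations.

Theorem theorem1p2 (F : fieldType) (A : comAlgType F)
    (D : (A -> A) -> Prop)
    (D_derivations : exists S : (A -> A) -> Prop,
       [/\ forall f, S f -> derivation f, pairwise_commuting S
         & spanned_by S D])
    (D_nonzero : nonzero_space D)
    (disp : Order.disp_t) (I : orderType disp) (d : I -> A -> A)
    (d_basis : is_basis D d) :
  weyl_simple d <->
  D_simple D /\ acts_faithfully d (@constants_AD F A I D).
Proof.
have [S [S_der S_comm D_S]] := D_derivations; have [_ D_d] := d_basis.
have d_S i : exists n (c : 'I_n -> F) (g : 'I_n -> A -> A),
    (forall k, S (g k)) /\ forall x, d i x = \sum_(k < n) c k *: g k x.
  exact/D_S/(mem_span_der D_d).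
have d_der i : derivation (d i).
  have [n [c [g [Sg dE]]]] := d_S i.
  by apply: derivation_span dE => k; apply: S_der.
have d_comm i j x : d i (d j x) = d j (d i x).
  have S_d f y : S f -> f (d j y) = d j (f y).
    move=> Sf; have [n [c [g [Sg dE]]]] := d_S j.
    by apply: (der_comm_span (S_der _ Sf) _ dE) => k; apply: S_comm.
  have [n [c [g [Sg dE]]]] := d_S i; apply/esym.
  by apply: (der_comm_span (d_der j) _ dE) => k z; rewrite S_d.
split=> [simp|[Dsimple faithful]].
  split; first exact: (simple_D_simple d_comm D_d).
  exact: simple_faithful.
split=> [|S0 S0_ideal].
  exists << 1 *g mone >>, << 1 *g mone >>; rewrite weyl_mulCl // scale1r.
  by move/eqP; rewrite monalgU_eq0 oner_eq0.
have [all0|] := classic (forall p, S0 p -> p = 0); first by left.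
move=> not0; right=> p.
have [q nq] := not_all_ex_not _ _ not0; have [Sq q0] := imply_to_and _ _ nq.
rewrite -(weyl_mulr1 d_der d_comm p); have [_ _ SMl _] := S0_ideal; apply: SMl.
exact: (two_sided_one d_der d_comm D_d S0_ideal Dsimple faithful Sq q0).
Qed.
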